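(* Let $\{b_n\}_{n\in\mathbb Z}$ be a real sequence with $b_n\ge 0$ for all $n$ and $\{b_n\}\in \ell^{3/2}(\mathbb Z)$. Consider on $\ell^2(\mathbb Z)$ the discrete Schrödinger operator $$H_D\varphi(n)=D^*D\varphi(n)-b_n\varphi(n)=-\varphi(n+1)-\varphi(n-1)+2\varphi(n)-b_n\varphi(n),\qquad n\in\mathbb Z.$$ Then the negative spectrum of $H_D$ consists of discrete eigenvalues $\{e_j\}$, and they satisfy $$\sum_j |e_j|\le \frac{\pi}{\sqrt3}\,L^{cl}_{1,1}\sum_{n\in\mathbb Z} b_n^{3/2},$$ where $L^{cl}_{1,1}=\dfrac{\Gamma(2)}{2\sqrt{\pi}\,\Gamma(5/2)}$ (so that $\frac{\pi}{\sqrt3}L^{cl}_{1,1}=\frac{2}{3\sqrt3}$).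
   Context: $D$ is the forward difference operator on $\ell^2(\mathbb Z)$, $D\varphi(n)=\varphi(n+1)-\varphi(n)$, with adjoint $D^*\varphi(n)=-(\varphi(n)-\varphi(n-1))$, so $D^*D$ is the discrete Laplacian with spectrum $[0,4]$. In general $L^{cl}_{\gamma,1}=\frac{\Gamma(\gamma+1)}{2\sqrt\pi\,\Gamma(\gamma+3/2)}$. *)

(* Defs.v *)
From Stdlib Require Import Reals ZArith Lra.
From Coquelicot Require Import Coquelicot.
Open Scope R_scope.

Definition ex_sumZ (f : Z -> R) : Prop :=
  ex_series (fun k : nat => f (Z.of_nat k)) /\
  ex_series (fun k : nat => f (- Z.of_nat k - 1)%Z).

Definition sumZ (f : Z -> R) : R :=
  Series (fun k : nat => f (Z.of_nat k)) + Series (fun k : nat => f (- Z.of_nat k - 1)%Z).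

Definition in_l32 (b : Z -> R) : Prop := ex_sumZ (fun n => Rabs (b n) * sqrt (Rabs (b n))).

Definition is_l2 (phi : Z -> R) : Prop := ex_sumZ (fun n => (phi n)^2).
Definition inner (phi psi : Z -> R) : R := sumZ (fun n => phi n * psi n).

Definition HD (b : Z -> R) (phi : Z -> R) (n : Z) : R :=
  - phi (n + 1)%Z - phi (n - 1)%Z + 2 * phi n - b n * phi n.

Definition in_spectrum (b : Z -> R) (lam : R) : Prop :=
  ~ (forall psi, is_l2 psi ->
       exists phi, is_l2 phi /\ (forall n, HD b phi n - lam * phi n = psi n) /\
         forall phi', is_l2 phi' -> (forall n, HD b phi' n - lam * phi' n = psi n) ->
           phi' = phi).

Definition is_eigvec (b : Z -> R) (lam : R) (phi : Z -> R) : Prop :=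
  is_l2 phi /\ (forall n, HD b phi n = lam * phi n).

Fixpoint fsum (m : nat) (f : nat -> R) : R :=
  match m with O => 0 | S k => fsum k f + f k end.

Definition lin_indep (m : nat) (phi : nat -> Z -> R) : Prop :=
  forall c : nat -> R, (forall n, fsum m (fun j => c j * phi j n) = 0) ->
    forall j, (j < m)%nat -> c j = 0.

Definition discrete_eigenvalue (b : Z -> R) (lam : R) : Prop :=
  (exists eps, 0 < eps /\ forall mu, 0 < Rabs (mu - lam) < eps -> ~ in_spectrum b mu) /\
  (exists phi, is_eigvec b lam phi /\ exists n, phi n <> 0) /\
  (exists N : nat, forall m phi, (forall j, (j < m)%nat -> is_eigvec b lam (phi j)) ->
       lin_indep m phi -> (m <= N)%nat).

(* L^cl_{1,1} = Gamma(2) / (2 sqrt pi Gamma(5/2)), with Gamma(2) = 1, Gamma(5/2) = 3 sqrt pi / 4 *)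
Definition Lcl11 : R := 1 / (2 * sqrt PI * (3 / 4 * sqrt PI)).

(* Main.v *)
(* Trace bound. Eden and Foias: apply the discrete Agmon inequality [phi(n)^2 <= |phi| |D phi|] to the
   combination of orthonormal eigenvectors [phi_j] with coefficients [phi_j(n)] and sum over [n];
   the density [rho = sum_j phi_j^2] then satisfies [sum rho^3 <= sum_j |D phi_j|^2], whence
   [sum_j |e_j| <= sum_n (b rho - rho^3) <= 2/(3 sqrt 3) sum_n b^(3/2)].

   Discreteness. For [lam < 0], [HD b - lam] is a finite-rank perturbation of a diagonally dominant
   Jacobi operator, which is inverted by monotone iteration; hence [lam] is in the spectrum only if it
   is an eigenvalue. Eigenvalues cannot accumulate at [lam < 0], since eigenvectors for distinct
   eigenvalues are orthogonal and the trace bound limits the number of eigenvalues below [lam/2]. *)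

Require Import Defs.
From Stdlib Require Import Reals ZArith Lra Lia Classical FunctionalExtensionality IndefiniteDescription.
From Coquelicot Require Import Coquelicot.
Open Scope R_scope.

(** * Summation over the integers *)

(** [sumZ] returns a number even for a divergent family, so convergence is bundled with the value
    and the rules below carry both at once. *)
Definition is_sumZ (f : Z -> R) (l : R) : Prop := ex_sumZ f /\ sumZ f = l.

Lemma is_sumZ_sumZ (f : Z -> R) : ex_sumZ f -> is_sumZ f (sumZ f).
Proof. now split. Qed.

Lemma is_sumZ_ext (f g : Z -> R) (l : R) :
  (forall n, f n = g n) -> is_sumZ f l -> is_sumZ g l.
Proof. intros E; now rewrite (functional_extensionality _ _ E). Qed.

Lemma is_sumZ_plus (f g : Z -> R) (l l' : R) :
  is_sumZ f l -> is_sumZ g l' -> is_sumZ (fun n => f n + g n) (l + l').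
Proof.
  intros [[F1 F2] <-] [[G1 G2] <-]; split.
  - split; now apply @ex_series_plus.
  - unfold sumZ; rewrite !Series_plus by assumption; ring.
Qed.

Lemma is_sumZ_scal (c : R) (f : Z -> R) (l : R) :
  is_sumZ f l -> is_sumZ (fun n => c * f n) (c * l).
Proof.
  intros [[F1 F2] <-]; split.
  - split; now apply @ex_series_scal.
  - unfold sumZ; rewrite !Series_scal_l; ring.
Qed.

Lemma is_sumZ_minus (f g : Z -> R) (l l' : R) :
  is_sumZ f l -> is_sumZ g l' -> is_sumZ (fun n => f n - g n) (l - l').
Proof.
  intros F G; replace (l - l') with (l + -1 * l') by ring.
  apply (is_sumZ_ext (fun n => f n + -1 * g n)); [intros; ring|].
  now apply is_sumZ_plus, is_sumZ_scal.
Qed.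

Lemma ex_sumZ_le (f g : Z -> R) :
  (forall n, Rabs (f n) <= g n) -> ex_sumZ g -> ex_sumZ f.
Proof.
  intros L [G1 G2]; split.
  - apply @ex_series_le with (2 := G1); intros; apply L.
  - apply @ex_series_le with (2 := G2); intros; apply L.
Qed.

Lemma is_series_zero : is_series (fun _ : nat => 0) 0.
Proof.
  change (is_lim_seq (sum_n (fun _ : nat => 0)) 0).
  apply (is_lim_seq_ext (fun _ => 0)); [|apply is_lim_seq_const].
  intros n; symmetry; induction n as [|n IH].
  - now rewrite sum_O.
  - rewrite sum_Sn, IH; apply Rplus_0_l.
Qed.

Lemma is_sumZ_zero : is_sumZ (fun _ => 0) 0.
Proof.
  split; [split; exists 0; exact is_series_zero|].
  unfold sumZ; rewrite (is_series_unique _ _ is_series_zero); ring.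
Qed.

Lemma Series_nonneg (a : nat -> R) : (forall k, 0 <= a k) -> ex_series a -> 0 <= Series a.
Proof.
  intros P E; rewrite <- (is_series_unique _ _ is_series_zero).
  apply Series_le; [intros k; split; [lra|apply P]|exact E].
Qed.

Lemma is_sumZ_nonneg (f : Z -> R) (l : R) : (forall n, 0 <= f n) -> is_sumZ f l -> 0 <= l.
Proof.
  intros P [[F1 F2] <-]; apply Rplus_le_le_0_compat; apply Series_nonneg; auto.
Qed.

Lemma is_sumZ_le (f g : Z -> R) (l l' : R) :
  (forall n, f n <= g n) -> is_sumZ f l -> is_sumZ g l' -> l <= l'.
Proof.
  intros L F G; apply Rminus_le_0, (is_sumZ_nonneg (fun n => g n - f n)).
  - intros n; specialize (L n); lra.
  - now apply is_sumZ_minus.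
Qed.

(** The shift moves the single term [f 0] from the nonnegative half-line to the negative one. *)
Lemma is_sumZ_succ (f : Z -> R) (l : R) : is_sumZ f l -> is_sumZ (fun n => f (n + 1)%Z) l.
Proof.
  intros [[F1 F2] <-].
  assert (E1 : (fun k : nat => f (Z.of_nat k + 1)%Z) = (fun k => f (Z.of_nat (S k)))).
  { apply functional_extensionality; intros k; f_equal; lia. }
  assert (E2 : (fun k : nat => f (- Z.of_nat (S k) - 1 + 1)%Z)
                 = (fun k : nat => f (- Z.of_nat k - 1)%Z)).
  { apply functional_extensionality; intros k; f_equal; lia. }
  assert (X2 : ex_series (fun k : nat => f (- Z.of_nat k - 1 + 1)%Z)).
  { apply ex_series_incr_1; now rewrite E2. }
  split.
  - split; [|exact X2].
    rewrite E1; exact (proj1 (ex_series_incr_1 (fun k : nat => f (Z.of_nat k))) F1).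
  - unfold sumZ; rewrite (Series_incr_1 _ X2), E1, E2, (Series_incr_1 _ F1); simpl; ring.
Qed.

Lemma is_sumZ_pred (f : Z -> R) (l : R) : is_sumZ f l -> is_sumZ (fun n => f (n - 1)%Z) l.
Proof.
  intros [[F1 F2] <-].
  assert (E1 : (fun k : nat => f (- Z.of_nat k - 1 - 1)%Z)
                 = (fun k => f (- Z.of_nat (S k) - 1)%Z)).
  { apply functional_extensionality; intros k; f_equal; lia. }
  assert (E2 : (fun k : nat => f (Z.of_nat (S k) - 1)%Z) = (fun k : nat => f (Z.of_nat k))).
  { apply functional_extensionality; intros k; f_equal; lia. }
  assert (X2 : ex_series (fun k : nat => f (Z.of_nat k - 1)%Z)).
  { apply ex_series_incr_1; now rewrite E2. }
  split.
  - split; [exact X2|].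
    rewrite E1; exact (proj1 (ex_series_incr_1 (fun k : nat => f (- Z.of_nat k - 1)%Z)) F2).
  - unfold sumZ; rewrite (Series_incr_1 _ X2), E1, E2, (Series_incr_1 _ F2); simpl; ring.
Qed.

Lemma is_sumZ_shift (m : Z) (f : Z -> R) (l : R) :
  is_sumZ f l -> is_sumZ (fun n => f (n + m)%Z) l.
Proof.
  intros F; induction m as [|m IH|m IH] using Z.peano_ind.
  - apply is_sumZ_ext with (2 := F); intros; f_equal; lia.
  - apply is_sumZ_ext with (2 := is_sumZ_succ _ _ IH); intros; simpl; f_equal; lia.
  - apply is_sumZ_ext with (2 := is_sumZ_pred _ _ IH); intros; simpl; f_equal; lia.
Qed.

Lemma ex_sumZ_shift (m : Z) (f : Z -> R) : ex_sumZ f -> ex_sumZ (fun n => f (n + m)%Z).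
Proof. intros F; apply (is_sumZ_shift m f (sumZ f)); now apply is_sumZ_sumZ. Qed.

(** After a shift by [n] the term in question heads the first half-series, and all that remains is
    nonnegative. *)
Lemma is_sumZ_term (f : Z -> R) (l : R) (n : Z) :
  (forall k, 0 <= f k) -> is_sumZ f l -> f n <= l.
Proof.
  intros P F; destruct (is_sumZ_shift n f l F) as [[F1 F2] <-].
  unfold sumZ; rewrite (Series_incr_1 _ F1); simpl.
  assert (0 <= Series (fun k : nat => f (Z.of_nat (S k) + n)%Z)).
  { apply Series_nonneg; [intros; apply P|].
    exact (proj1 (ex_series_incr_1 (fun k : nat => f (Z.of_nat k + n)%Z)) F1). }
  assert (0 <= Series (fun k : nat => f (- Z.of_nat k - 1 + n)%Z)).
  { apply Series_nonneg; [intros; apply P|exact F2]. }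
  simpl in *; lra.
Qed.

Lemma is_sumZ_single (m : Z) (x : R) : is_sumZ (fun n => if Z.eqb n m then x else 0) x.
Proof.
  apply (is_sumZ_ext (fun n => (fun k => if Z.eqb k 0 then x else 0) (n + - m)%Z)).
  { intros n; destruct (Z.eqb_spec (n + - m) 0), (Z.eqb_spec n m); auto; lia. }
  apply (is_sumZ_shift (- m) (fun k => if Z.eqb k 0 then x else 0)).
  assert (E : ex_series (fun k : nat => (if Z.eqb (Z.of_nat k) 0 then x else 0) : R)).
  { apply ex_series_incr_1; simpl; exists 0; exact is_series_zero. }
  assert (E' : (fun k : nat => if (- Z.of_nat k - 1 =? 0)%Z then x else 0) = (fun _ => 0)).
  { apply functional_extensionality; intros k.
    destruct (Z.eqb_spec (- Z.of_nat k - 1) 0); auto; lia. }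
  unfold is_sumZ, ex_sumZ, sumZ; cbv beta; rewrite E'; split.
  - split; [exact E|exists 0; exact is_series_zero].
  - rewrite (Series_incr_1 _ E); simpl.
    rewrite (is_series_unique _ _ is_series_zero); ring.
Qed.

(** * Limits of nonnegative series: Fatou's lemma *)

Lemma is_lim_seq_sum_n (a : nat -> nat -> R) (a' : nat -> R) (N : nat) :
  (forall n, is_lim_seq (fun k => a k n) (a' n)) ->
  is_lim_seq (fun k => sum_n (a k) N) (sum_n a' N).
Proof.
  intros L; induction N as [|N IH].
  - rewrite sum_O; apply (is_lim_seq_ext (fun k => a k O)); [|apply L].
    intros; now rewrite sum_O.
  - rewrite sum_Sn; apply (is_lim_seq_ext (fun k => sum_n (a k) N + a k (S N))).
    + intros; now rewrite sum_Sn.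
    + now apply is_lim_seq_plus'.
Qed.

Lemma ex_series_bounded (a : nat -> R) (C : R) :
  (forall k, 0 <= a k) -> (forall N, sum_n a N <= C) -> ex_series a.
Proof.
  intros P B; destruct (ex_finite_lim_seq_incr (sum_n a) C) as [l Hl]; [|exact B|now exists l].
  intros n; rewrite sum_Sn; specialize (P (S n)); unfold plus; simpl; lra.
Qed.

Lemma sum_n_le_Series (a : nat -> R) (N : nat) :
  (forall k, 0 <= a k) -> ex_series a -> sum_n a N <= Series a.
Proof.
  intros P E; apply (is_lim_seq_incr_compare (sum_n a)).
  - exact (Series_correct _ E).
  - intros n; rewrite sum_Sn; specialize (P (S n)); unfold plus; simpl; lra.
Qed.

(** Each partial sum of the limit is a limit of partial sums, all of them at most [C]. *)
Lemma ex_series_fatou (a : nat -> nat -> R) (a' : nat -> R) (C : R) :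
  (forall k n, 0 <= a k n) -> (forall k, ex_series (a k) /\ Series (a k) <= C) ->
  (forall n, is_lim_seq (fun k => a k n) (a' n)) -> ex_series a'.
Proof.
  intros P B L; apply (ex_series_bounded _ C).
  - intros n; apply (is_lim_seq_le (fun _ => 0) (fun k => a k n) 0 (a' n)); auto.
    apply is_lim_seq_const.
  - intros N; apply (is_lim_seq_le (fun k => sum_n (a k) N) (fun _ => C)
                       (sum_n a' N) C).
    + intros k; destruct (B k) as [E K].
      apply Rle_trans with (2 := K); now apply sum_n_le_Series.
    + now apply is_lim_seq_sum_n.
    + apply is_lim_seq_const.
Qed.

Lemma ex_sumZ_fatou (f : nat -> Z -> R) (f' : Z -> R) (C : R) :
  (forall k n, 0 <= f k n) -> (forall k, exists l, is_sumZ (f k) l /\ l <= C) ->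
  (forall n, is_lim_seq (fun k => f k n) (f' n)) -> ex_sumZ f'.
Proof.
  intros P B L; split.
  - apply (ex_series_fatou (fun k j => f k (Z.of_nat j)) _ C); auto.
    intros k; destruct (B k) as (l & [[E1 E2] <-] & K); split; [exact E1|].
    assert (0 <= Series (fun j : nat => f k (- Z.of_nat j - 1)%Z)) by now apply Series_nonneg.
    unfold sumZ in K; lra.
  - apply (ex_series_fatou (fun k j => f k (- Z.of_nat j - 1)%Z) _ C); auto.
    intros k; destruct (B k) as (l & [[E1 E2] <-] & K); split; [exact E2|].
    assert (0 <= Series (fun j : nat => f k (Z.of_nat j))) by now apply Series_nonneg.
    unfold sumZ in K; lra.
Qed.

(** * Finite sums *)

Lemma fsum_ext (m : nat) (f g : nat -> R) :
  (forall j, (j < m)%nat -> f j = g j) -> fsum m f = fsum m g.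
Proof.
  induction m as [|m IH]; intros E; simpl; [reflexivity|].
  rewrite IH, E; auto.
Qed.

Lemma fsum_plus (m : nat) (f g : nat -> R) :
  fsum m (fun j => f j + g j) = fsum m f + fsum m g.
Proof. induction m as [|m IH]; simpl; [ring|rewrite IH; ring]. Qed.

Lemma fsum_scal (m : nat) (c : R) (f : nat -> R) :
  fsum m (fun j => c * f j) = c * fsum m f.
Proof. induction m as [|m IH]; simpl; [ring|rewrite IH; ring]. Qed.

Lemma fsum_le (m : nat) (f g : nat -> R) :
  (forall j, (j < m)%nat -> f j <= g j) -> fsum m f <= fsum m g.
Proof.
  induction m as [|m IH]; intros L; simpl; [lra|].
  apply Rplus_le_compat; auto.
Qed.

Lemma fsum_zero (m : nat) : fsum m (fun _ => 0) = 0.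
Proof. induction m as [|m IH]; simpl; [|rewrite IH]; ring. Qed.

Lemma fsum_const (m : nat) (c : R) : fsum m (fun _ => c) = INR m * c.
Proof. induction m as [|m IH]; [simpl; ring|]. rewrite S_INR; simpl; rewrite IH; ring. Qed.

Lemma fsum_single (m k : nat) (f : nat -> R) :
  (k < m)%nat -> fsum m (fun j => f j * (if Nat.eqb k j then 1 else 0)) = f k.
Proof.
  intros K; induction m as [|m IH]; [lia|simpl].
  destruct (Nat.eqb_spec k m) as [->|D].
  - rewrite (fsum_ext _ _ (fun _ => 0)); [rewrite fsum_zero; ring|].
    intros j J; destruct (Nat.eqb_spec m j); [lia|ring].
  - rewrite IH by lia; ring.
Qed.

Lemma is_sumZ_fsum (m : nat) (f : nat -> Z -> R) (l : nat -> R) :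
  (forall j, (j < m)%nat -> is_sumZ (f j) (l j)) ->
  is_sumZ (fun n => fsum m (fun j => f j n)) (fsum m l).
Proof.
  induction m as [|m IH]; intros F; simpl; [apply is_sumZ_zero|].
  apply is_sumZ_plus; auto.
Qed.

(** * Square-summable sequences *)

Lemma ex_sumZ_mult (phi psi : Z -> R) :
  is_l2 phi -> is_l2 psi -> ex_sumZ (fun n => phi n * psi n).
Proof.
  intros F G; apply (ex_sumZ_le _ (fun n => phi n ^ 2 + psi n ^ 2)).
  - intros n; apply Rabs_le.
    pose proof (pow2_ge_0 (phi n + psi n)); pose proof (pow2_ge_0 (phi n - psi n)); nra.
  - exact (proj1 (is_sumZ_plus _ _ _ _ (is_sumZ_sumZ _ F) (is_sumZ_sumZ _ G))).
Qed.

Lemma is_l2_scal (c : R) (phi : Z -> R) : is_l2 phi -> is_l2 (fun n => c * phi n).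
Proof.
  intros F; apply (is_sumZ_ext (fun n => c ^ 2 * phi n ^ 2) _ (c ^ 2 * sumZ (fun n => phi n ^ 2))).
  - intros; ring.
  - now apply is_sumZ_scal, is_sumZ_sumZ.
Qed.

Lemma is_l2_plus (phi psi : Z -> R) :
  is_l2 phi -> is_l2 psi -> is_l2 (fun n => phi n + psi n).
Proof.
  intros F G; apply (ex_sumZ_le _ (fun n => 2 * phi n ^ 2 + 2 * psi n ^ 2)).
  - intros n; rewrite Rabs_right by (apply Rle_ge, pow2_ge_0).
    pose proof (pow2_ge_0 (phi n - psi n)); nra.
  - exact (proj1 (is_sumZ_plus _ _ _ _ (is_sumZ_scal 2 _ _ (is_sumZ_sumZ _ F))
                    (is_sumZ_scal 2 _ _ (is_sumZ_sumZ _ G)))).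
Qed.

Lemma is_l2_fsum (m : nat) (phi : nat -> Z -> R) :
  (forall j, (j < m)%nat -> is_l2 (phi j)) -> is_l2 (fun n => fsum m (fun j => phi j n)).
Proof.
  induction m as [|m IH]; intros F; simpl.
  - apply (is_sumZ_ext (fun _ => 0) _ 0); [intros; ring|apply is_sumZ_zero].
  - apply is_l2_plus; auto.
Qed.

Lemma is_l2_shift (m : Z) (phi : Z -> R) : is_l2 phi -> is_l2 (fun n => phi (n + m)%Z).
Proof. intros F; exact (ex_sumZ_shift m (fun n => phi n ^ 2) F). Qed.

Lemma is_l2_le (phi psi : Z -> R) :
  (forall n, Rabs (phi n) <= Rabs (psi n)) -> is_l2 psi -> is_l2 phi.
Proof.
  intros L; apply ex_sumZ_le; intros n.
  rewrite <- (pow2_abs (psi n)), <- RPow_abs; specialize (L n).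
  pose proof (Rabs_pos (phi n)); nra.
Qed.

(** * The Lieb-Thirring bound *)

Lemma is_series_telescope (a : nat -> R) :
  is_lim_seq a 0 -> is_series (fun k => a (S k) - a k) (- a O).
Proof.
  intros L.
  change (is_lim_seq (sum_n (fun k => a (S k) - a k)) (- a O)).
  apply (is_lim_seq_ext (fun k => a (S k) + - a O)).
  - intros n; induction n as [|n IH].
    + now rewrite sum_O.
    + rewrite sum_Sn, <- IH; unfold plus; simpl; ring.
  - replace (Finite (- a O)) with (Finite (0 + - a O)) by (f_equal; ring).
    apply is_lim_seq_plus'; [now apply is_lim_seq_incr_1 in L|apply is_lim_seq_const].
Qed.

Lemma Series_variation (a : nat -> R) :
  is_lim_seq a 0 -> ex_series (fun k => Rabs (a (S k) - a k)) ->
  Rabs (a O) <= Series (fun k => Rabs (a (S k) - a k)).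
Proof.
  intros L E; rewrite <- Rabs_Ropp, <- (is_series_unique _ _ (is_series_telescope a L)).
  now apply Series_Rabs.
Qed.

(** Summability makes [g] vanish at both ends, so [g n] is at most the variation to the right of [n]
    and also at most the variation to its left; adding the two gives the factor 2. *)
Lemma two_mul_le_variation (g : Z -> R) (V : R) (n : Z) :
  ex_sumZ g -> is_sumZ (fun k => Rabs (g (k + 1)%Z - g k)) V -> 2 * g n <= V.
Proof.
  intros G F.
  (* With [n] moved to 0, the two series in [sumZ] are exactly the variations over the two
     half-lines. *)
  apply (ex_sumZ_shift n) in G; apply (is_sumZ_shift n) in F.
  set (h := fun k => g (k + n)%Z); replace (g n) with (h 0%Z) by reflexivity.
  assert (F' : is_sumZ (fun k => Rabs (h (k + 1)%Z - h k)) V).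
  { apply is_sumZ_ext with (2 := F); intros k; unfold h; do 3 f_equal; lia. }
  destruct F' as [[F1 F2] <-]; destruct G as [G1 G2].
  change (ex_series (fun k => h (Z.of_nat k))) in G1.
  change (ex_series (fun k => h (- Z.of_nat k - 1)%Z)) in G2.
  assert (E1 : (fun k => Rabs (h (Z.of_nat k + 1)%Z - h (Z.of_nat k)))
      = (fun k => Rabs (h (Z.of_nat (S k)) - h (Z.of_nat k)))).
  { apply functional_extensionality; intros k; do 3 f_equal; lia. }
  assert (E2 : (fun k => Rabs (h (- Z.of_nat k - 1 + 1)%Z - h (- Z.of_nat k - 1)%Z))
      = (fun k => Rabs (h (- Z.of_nat (S k))%Z - h (- Z.of_nat k)%Z))).
  { apply functional_extensionality; intros k.
    rewrite Rabs_minus_sym; f_equal; f_equal; f_equal; lia. }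
  unfold sumZ; rewrite E1, E2 in *.
  assert (L2 : is_lim_seq (fun k => h (- Z.of_nat k)%Z) 0).
  { apply is_lim_seq_incr_1.
    apply is_lim_seq_ext with (2 := ex_series_lim_0 _ G2); intros k; f_equal; lia. }
  pose proof (Series_variation (fun k => h (Z.of_nat k)) (ex_series_lim_0 _ G1) F1) as V1.
  pose proof (Series_variation (fun k => h (- Z.of_nat k)%Z) L2 F2) as V2.
  simpl in V1, V2; pose proof (Rle_abs (h 0%Z)); simpl; lra.
Qed.

Definition fwd_diff (phi : Z -> R) (n : Z) : R := phi (n + 1)%Z - phi n.

Lemma is_l2_fwd_diff (phi : Z -> R) : is_l2 phi -> is_l2 (fwd_diff phi).
Proof.
  intros F.
  apply (is_sumZ_ext (fun n => (phi (n + 1)%Z + -1 * phi n) ^ 2) _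
           (sumZ (fun n => (phi (n + 1)%Z + -1 * phi n) ^ 2))).
  - intros; unfold fwd_diff; ring.
  - apply is_sumZ_sumZ, (is_l2_plus (fun n => phi (n + 1)%Z)).
    + now apply is_l2_shift.
    + now apply is_l2_scal.
Qed.

(* The discrete Agmon inequality [phi(n)^2 <= |phi| |D phi|], with the product of norms linearized
   by AM-GM so that no square root is needed. *)
Lemma agmon (phi : Z -> R) (A B t : R) (n : Z) : 0 < t ->
  is_sumZ (fun k => fwd_diff phi k ^ 2) A -> is_sumZ (fun k => phi k ^ 2) B ->
  2 * phi n ^ 2 <= t * A + B / t.
Proof.
  intros T FA FB.
  (* Weighted AM-GM majorant of |x^2 - y^2| = |x - y| |x + y|; both [phi k ^ 2] and its translate
     sum to [B], so [g] sums to [t * A + B / t]. *)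
  set (g := fun k => t * fwd_diff phi k ^ 2 + / (2 * t) * (phi (k + 1)%Z ^ 2 + phi k ^ 2)).
  assert (FG : is_sumZ g (t * A + / (2 * t) * (B + B))).
  { apply is_sumZ_plus; [now apply is_sumZ_scal|].
    apply is_sumZ_scal, is_sumZ_plus; [|exact FB].
    exact (is_sumZ_shift 1 (fun k => phi k ^ 2) B FB). }
  assert (L : forall k, Rabs (phi (k + 1)%Z ^ 2 - phi k ^ 2) <= g k).
  { intros k; unfold g, fwd_diff; set (x := phi (k + 1)%Z); set (y := phi k).
    replace (x ^ 2 - y ^ 2) with ((x - y) * (x + y)) by ring.
    assert (P : forall u v, u * v <= t * u ^ 2 + / (4 * t) * v ^ 2).
    { intros u v; pose proof (pow2_ge_0 (2 * t * u - v)).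
      assert (0 < / (4 * t)) by (apply Rinv_0_lt_compat; lra).
      assert (0 <= / (4 * t) * (2 * t * u - v) ^ 2) by (apply Rmult_le_pos; lra).
      replace (/ (4 * t) * (2 * t * u - v) ^ 2)
        with (t * u ^ 2 + / (4 * t) * v ^ 2 - u * v) in * by (field; lra). lra. }
    assert (Q : / (4 * t) * (x + y) ^ 2 <= / (2 * t) * (x ^ 2 + y ^ 2)).
    { replace (/ (2 * t)) with (/ (4 * t) * 2) by (field; lra).
      rewrite Rmult_assoc; apply Rmult_le_compat_l.
      - apply Rlt_le, Rinv_0_lt_compat; lra.
      - pose proof (pow2_ge_0 (x - y)); nra. }
    apply Rabs_le; split.
    - pose proof (P (- (x - y)) (x + y)) as P'.
      replace ((- (x - y)) ^ 2) with ((x - y) ^ 2) in P' by ring; lra.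
    - pose proof (P (x - y) (x + y)); lra. }
  assert (E : ex_sumZ (fun k => Rabs (phi (k + 1)%Z ^ 2 - phi k ^ 2))).
  { apply (ex_sumZ_le _ g); [|apply FG]; intros k; rewrite Rabs_Rabsolu; apply L. }
  apply Rle_trans with (sumZ (fun k => Rabs (phi (k + 1)%Z ^ 2 - phi k ^ 2))).
  - apply (two_mul_le_variation (fun k => phi k ^ 2)); [apply FB|now apply is_sumZ_sumZ].
  - apply Rle_trans with (t * A + / (2 * t) * (B + B)).
    + exact (is_sumZ_le _ _ _ _ L (is_sumZ_sumZ _ E) FG).
    + right; field; lra.
Qed.

(** * Density and kinetic energy of an orthonormal system *)

Lemma fsum_sqr (m : nat) (f : nat -> R) :
  fsum m f ^ 2 = fsum m (fun i => fsum m (fun j => f i * f j)).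
Proof.
  rewrite (fsum_ext _ (fun i => fsum m (fun j => f i * f j)) (fun i => fsum m f * f i)).
  - rewrite fsum_scal; ring.
  - intros i _; rewrite fsum_scal; ring.
Qed.

(** The squared norm of a combination is the quadratic form of the Gram matrix [G]. It serves both
    for the [phi j], where [G] is the identity, and for their differences. *)
Lemma is_sumZ_sqr_fsum (m : nat) (c : nat -> R) (f : nat -> Z -> R) (G : nat -> nat -> R) :
  (forall i j, (i < m)%nat -> (j < m)%nat -> is_sumZ (fun n => f i n * f j n) (G i j)) ->
  is_sumZ (fun n => fsum m (fun j => c j * f j n) ^ 2)
    (fsum m (fun i => fsum m (fun j => c i * c j * G i j))).
Proof.
  intros F.
  apply (is_sumZ_ext (fun n => fsum m (fun i => fsum m (fun j => c i * c j * (f i n * f j n))))).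
  - intros n; rewrite fsum_sqr; do 2 (apply fsum_ext; intros); ring.
  - do 2 (apply is_sumZ_fsum; intros); apply is_sumZ_scal; auto.
Qed.

Lemma fsum_fwd_diff (m : nat) (c : nat -> R) (phi : nat -> Z -> R) (n : Z) :
  fwd_diff (fun k => fsum m (fun j => c j * phi j k)) n
    = fsum m (fun j => c j * fwd_diff (phi j) n).
Proof.
  unfold fwd_diff; induction m as [|m IH]; simpl; [ring|rewrite <- IH; ring].
Qed.

(* Eden and Foias: Agmon's inequality for the linear combination of the [phi j] with
   coefficients [phi j n], evaluated at the point [n]. *)
Lemma density_cube_le (m : nat) (phi : nat -> Z -> R) (G : nat -> nat -> R) (n : Z) :
  (forall i j, (i < m)%nat -> (j < m)%nat ->
     is_sumZ (fun k => phi i k * phi j k) (if Nat.eqb i j then 1 else 0)) ->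
  (forall i j, (i < m)%nat -> (j < m)%nat ->
     is_sumZ (fun k => fwd_diff (phi i) k * fwd_diff (phi j) k) (G i j)) ->
  fsum m (fun j => phi j n ^ 2) ^ 3
    <= fsum m (fun i => fsum m (fun j => phi i n * phi j n * G i j)).
Proof.
  intros O D.
  set (A := fsum m (fun i => fsum m (fun j => phi i n * phi j n * G i j))).
  set (rho := fsum m (fun j => phi j n ^ 2)).
  set (Phi := fun k => fsum m (fun j => phi j n * phi j k)).
  assert (FB : is_sumZ (fun k => Phi k ^ 2) rho).
  { replace rho with (fsum m (fun i => fsum m (fun j =>
      phi i n * phi j n * (if Nat.eqb i j then 1 else 0)))).
    - now apply is_sumZ_sqr_fsum.
    - apply fsum_ext; intros i I.
      rewrite (fsum_single m i (fun j => phi i n * phi j n)) by exact I; ring. }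
  assert (FA : is_sumZ (fun k => fwd_diff Phi k ^ 2) A).
  { apply (is_sumZ_ext (fun k => fsum m (fun j => phi j n * fwd_diff (phi j) k) ^ 2)).
    - intros k; unfold Phi; now rewrite fsum_fwd_diff.
    - now apply is_sumZ_sqr_fsum. }
  assert (PA : 0 <= A) by (apply is_sumZ_nonneg with (2 := FA); intros; apply pow2_ge_0).
  assert (PB : 0 <= rho) by (apply is_sumZ_nonneg with (2 := FB); intros; apply pow2_ge_0).
  destruct PB as [PB|<-]; [|simpl; lra].
  assert (E : Phi n = rho) by (unfold Phi, rho; apply fsum_ext; intros; ring).
  (* The weight [/ rho] turns Agmon's inequality into 2 rho^2 <= A / rho + rho^2, that is, rho^3 <=
     A. *)
  pose proof (agmon Phi A rho (/ rho) n (Rinv_0_lt_compat _ PB) FA FB) as L.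
  rewrite E in L.
  replace (rho / / rho) with (rho ^ 2) in L by (field; lra).
  assert (L' : rho * rho ^ 2 <= rho * (/ rho * A)) by (apply Rmult_le_compat_l; lra).
  rewrite <- Rmult_assoc, Rinv_r in L' by lra; simpl in *; lra.
Qed.

(** The eigenvalue equation is paired with [phi] and summed by parts. *)
Lemma eigvec_potential_energy (b : Z -> R) (lam : R) (phi : Z -> R) (A B : R) :
  is_eigvec b lam phi -> is_sumZ (fun k => fwd_diff phi k * fwd_diff phi k) A ->
  is_sumZ (fun k => phi k * phi k) B -> is_sumZ (fun k => b k * phi k ^ 2) (A - lam * B).
Proof.
  intros [F E] FA FB.
  pose proof (is_sumZ_succ _ _ FB) as FB1; cbv beta in FB1.
  pose proof (is_sumZ_pred _ _ FA) as FA'; cbv beta in FA'.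
  pose proof (is_sumZ_pred _ _ FB) as FB'; cbv beta in FB'.
  replace (A - lam * B) with (/ 2 * (A + A + 2 * B - B - B) - lam * B) by field.
  (* The products of neighbours in [phi k * HD b phi k] are rewritten through squares, so that only
     translates of the two given sums occur. *)
  apply (is_sumZ_ext (fun k => / 2 * (fwd_diff phi k * fwd_diff phi k
      + fwd_diff phi (k - 1)%Z * fwd_diff phi (k - 1)%Z
      + 2 * (phi k * phi k) - phi (k + 1)%Z * phi (k + 1)%Z - phi (k - 1)%Z * phi (k - 1)%Z)
      - lam * (phi k * phi k))).
  - intros k; specialize (E k); unfold HD in E; unfold fwd_diff.
    replace (k - 1 + 1)%Z with k by lia.
    replace (lam * (phi k * phi k)) with ((lam * phi k) * phi k) by ring.
    rewrite <- E; field.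
  - repeat (assumption || apply is_sumZ_minus || apply is_sumZ_plus || apply is_sumZ_scal).
Qed.

(** For fixed [x] the left side is largest at rho = sqrt(x / 3), which produces the constant. *)
Lemma mult_sub_cube_le (x rho : R) : 0 <= x -> 0 <= rho ->
  x * rho - rho ^ 3 <= 2 / (3 * sqrt 3) * (x * sqrt x).
Proof.
  intros X P; set (s := sqrt x); set (r := sqrt 3).
  assert (S0 : 0 <= s) by apply sqrt_pos.
  assert (S2 : s * s = x) by now apply sqrt_sqrt.
  assert (R0 : 0 < r) by (apply sqrt_lt_R0; lra).
  assert (R2 : r * r = 3) by (apply sqrt_sqrt; lra).
  (* The maximizer: with x = 3 u^2, the right side minus the left side equals (rho - u)^2 (rho + 2
     u). *)
  set (u := s / r).
  assert (U : s = u * r) by (unfold u; field; lra).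
  assert (U0 : 0 <= u) by (apply Rmult_le_pos; [|apply Rlt_le, Rinv_0_lt_compat]; lra).
  rewrite <- S2, U.
  replace (2 / (3 * r) * (u * r * (u * r) * (u * r))) with (2 * u ^ 3 * (r * r) / 3)
    by (field; lra).
  replace (u * r * (u * r)) with (u * u * (r * r)) by ring.
  rewrite R2.
  assert (0 <= (rho - u) ^ 2 * (rho + 2 * u)) by (apply Rmult_le_pos; [apply pow2_ge_0|lra]).
  nra.
Qed.

Lemma lieb_thirring_constant : PI / sqrt 3 * Lcl11 = 2 / (3 * sqrt 3).
Proof.
  unfold Lcl11; pose proof PI_RGT_0 as P.
  assert (Q : sqrt PI * sqrt PI = PI) by (apply sqrt_sqrt; lra).
  assert (0 < sqrt 3) by (apply sqrt_lt_R0; lra).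
  replace (2 * sqrt PI * (3 / 4 * sqrt PI)) with (3 / 2 * (sqrt PI * sqrt PI)) by field.
  rewrite Q; field; lra.
Qed.

Lemma ex_sumZ_l32 (b : Z -> R) :
  (forall n, 0 <= b n) -> in_l32 b -> ex_sumZ (fun n => b n * sqrt (b n)).
Proof.
  intros P; apply ex_sumZ_le; intros n.
  rewrite (Rabs_right (b n)) by (apply Rle_ge, P).
  rewrite Rabs_right; [lra|].
  apply Rle_ge, Rmult_le_pos; [apply P|apply sqrt_pos].
Qed.

Lemma lieb_thirring (b : Z -> R) (m : nat) (e : nat -> R) (phi : nat -> Z -> R) :
  (forall n, 0 <= b n) -> in_l32 b ->
  (forall j, (j < m)%nat -> e j < 0 /\ is_eigvec b (e j) (phi j)) ->
  (forall i j, (i < m)%nat -> (j < m)%nat ->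
     inner (phi i) (phi j) = if Nat.eqb i j then 1 else 0) ->
  fsum m (fun j => Rabs (e j)) <= PI / sqrt 3 * Lcl11 * sumZ (fun n => b n * sqrt (b n)).
Proof.
  intros P B32 Eig Orth.
  set (G := fun i j => sumZ (fun k => fwd_diff (phi i) k * fwd_diff (phi j) k)).
  assert (L2 : forall j, (j < m)%nat -> is_l2 (phi j)) by (intros j J; apply Eig, J).
  assert (O : forall i j, (i < m)%nat -> (j < m)%nat ->
    is_sumZ (fun k => phi i k * phi j k) (if Nat.eqb i j then 1 else 0)).
  { intros i j I J; split; [apply ex_sumZ_mult; auto|now apply Orth]. }
  assert (D : forall i j, (i < m)%nat -> (j < m)%nat ->
    is_sumZ (fun k => fwd_diff (phi i) k * fwd_diff (phi j) k) (G i j)).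
  { intros i j I J; apply is_sumZ_sumZ, ex_sumZ_mult; apply is_l2_fwd_diff; auto. }
  assert (S1 : is_sumZ (fun n => fsum m (fun j => b n * phi j n ^ 2))
                 (fsum m (fun j => G j j - e j))).
  { apply is_sumZ_fsum; intros j J; replace (G j j - e j) with (G j j - e j * 1) by ring.
    apply (eigvec_potential_energy b (e j) (phi j)); [now apply Eig|now apply D|].
    generalize (O j j J J); now rewrite Nat.eqb_refl. }
  (* The bound on rho(n)^3, summed over [n]: orthonormality leaves only the diagonal of [G], the
     total kinetic energy. *)
  assert (S2 : is_sumZ (fun n => fsum m (fun i => fsum m (fun j => G i j * (phi i n * phi j n))))
                 (fsum m (fun j => G j j))).
  { replace (fsum m (fun j => G j j)) with
      (fsum m (fun i => fsum m (fun j => G i j * (if Nat.eqb i j then 1 else 0)))).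
    - do 2 (apply is_sumZ_fsum; intros); apply is_sumZ_scal; auto.
    - apply fsum_ext; intros i I; now apply fsum_single. }
  (* As all [e j] are negative, the left side is the total of [S1] minus that of [S2], and the claim
     reduces to a comparison at each site [n]. *)
  replace (fsum m (fun j => Rabs (e j)))
    with (fsum m (fun j => G j j - e j) - fsum m (fun j => G j j)).
  2:{ transitivity (fsum m (fun j => G j j - e j) + -1 * fsum m (fun j => G j j)); [ring|].
      rewrite <- fsum_scal, <- fsum_plus; apply fsum_ext; intros j J.
      rewrite Rabs_left by now apply Eig. ring. }
  rewrite lieb_thirring_constant.
  refine (is_sumZ_le _ _ _ _ _ (is_sumZ_minus _ _ _ _ S1 S2)
            (is_sumZ_scal _ _ _ (is_sumZ_sumZ _ (ex_sumZ_l32 b P B32)))).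
  intros n; cbv beta; rewrite fsum_scal.
  pose proof (density_cube_le m phi G n O D) as C.
  replace (fsum m (fun i => fsum m (fun j => G i j * (phi i n * phi j n))))
    with (fsum m (fun i => fsum m (fun j => phi i n * phi j n * G i j)))
    by (do 2 (apply fsum_ext; intros); ring).
  assert (0 <= fsum m (fun j => phi j n ^ 2)).
  { rewrite <- (fsum_zero m); apply fsum_le; intros; apply pow2_ge_0. }
  pose proof (mult_sub_cube_le (b n) (fsum m (fun j => phi j n ^ 2)) (P n)).
  lra.
Qed.

(** * Solvability of Jacobi equations and finite linear systems *)

Lemma fsum_update (m k : nat) (f : nat -> R) (x : R) : (k < m)%nat ->
  fsum m (fun j => if Nat.eqb j k then x else f j) = fsum m f + x - f k.
Proof.
  intros K; induction m as [|m IH]; [lia|simpl].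
  destruct (Nat.eqb_spec m k) as [->|D].
  - rewrite (fsum_ext k _ f); [ring|].
    intros j J; destruct (Nat.eqb_spec j k); [lia|reflexivity].
  - rewrite IH by lia; ring.
Qed.

(** Any n + 1 vectors in R^n are dependent: Gaussian elimination of the last coordinate, by
    induction on the dimension. *)
Lemma vectors_dependent (n : nat) (v : nat -> nat -> R) :
  exists c : nat -> R, (exists j, (j <= n)%nat /\ c j <> 0) /\
    forall i, (i < n)%nat -> fsum (S n) (fun j => c j * v j i) = 0.
Proof.
  revert v; induction n as [|n IH]; intros v.
  - exists (fun _ => 1); split; [exists O; split; [lia|lra]|intros; lia].
  - destruct (classic (exists k, (k <= n)%nat /\ v k n <> 0)) as [(k & K & V)|N].
    (* [v k] is the pivot, [t j] the multiple of it that clears the last coordinate of [v j], and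
       [p] enumerates the indices other than [k] by putting [S n] in the place of [k]. *)
    + set (t := fun j => v j n / v k n).
      set (p := fun j => if Nat.eqb j k then S n else j).
      destruct (IH (fun j i => v (p j) i - t (p j) * v k i)) as (c & (j & J & C) & H).
      set (T := fsum (S n) (fun j => c j * t (p j))).
      (* Since [p k = S n], the coefficient [c k] belongs to the vector [S n]; the pivot collects
         all the subtracted multiples. *)
      exists (fun j => if Nat.eqb j (S n) then c k else if Nat.eqb j k then - T else c j).
      assert (E : forall i, fsum (S (S n)) (fun j =>
          (if Nat.eqb j (S n) then c k else if Nat.eqb j k then - T else c j) * v j i)
        = fsum (S n) (fun j => c j * (v (p j) i - t (p j) * v k i))).
      { intros i; change (fsum (S (S n)) ?f) with (fsum (S n) f + f (S n)); cbv beta.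
        rewrite Nat.eqb_refl.
        rewrite (fsum_ext _ _ (fun j => if Nat.eqb j k then - T * v k i else c j * v j i)).
        2:{ intros l L; destruct (Nat.eqb_spec l (S n)); [lia|].
            destruct (Nat.eqb_spec l k); subst; reflexivity. }
        rewrite (fsum_ext _ (fun j => c j * (v (p j) i - t (p j) * v k i))
          (fun j => (if Nat.eqb j k then c k * v (S n) i else c j * v j i)
                    + - v k i * (c j * t (p j)))).
        2:{ intros l L; unfold p; destruct (Nat.eqb_spec l k); subst; ring. }
        rewrite fsum_plus, fsum_scal, !fsum_update by lia; fold T; ring. }
      split.
      * destruct (Nat.eq_dec j k) as [->|D].
        -- exists (S n); split; [lia|]; now rewrite Nat.eqb_refl.
        -- exists j; split; [lia|].
           destruct (Nat.eqb_spec j (S n)); [lia|]; destruct (Nat.eqb_spec j k); auto.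
      * intros i I; rewrite E; destruct (Nat.eq_dec i n) as [->|D]; [|apply H; lia].
        rewrite <- (fsum_zero (S n)); apply fsum_ext; intros; unfold t; field; exact V.
    (* Without a pivot the last coordinate of the first n + 1 vectors vanishes, and they are already
       dependent. *)
    + destruct (IH v) as (c & (j & J & C) & H).
      exists (fun j => if Nat.eqb j (S n) then 0 else c j); split.
      * exists j; split; [lia|]; destruct (Nat.eqb_spec j (S n)); [lia|exact C].
      * intros i I; change (fsum (S (S n)) ?f) with (fsum (S n) f + f (S n)); cbv beta.
        rewrite Nat.eqb_refl, Rmult_0_l, Rplus_0_r.
        rewrite (fsum_ext _ _ (fun j => c j * v j i)).
        2:{ intros l L; destruct (Nat.eqb_spec l (S n)); [lia|reflexivity]. }
        destruct (Nat.eq_dec i n) as [->|D]; [|apply H; lia].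
        rewrite <- (fsum_zero (S n)); apply fsum_ext; intros l L.
        destruct (Req_dec (v l n) 0) as [->|Q]; [ring|].
        exfalso; apply N; exists l; split; [lia|exact Q].
Qed.

(** The columns together with [y] are n + 1 vectors in R^n, hence dependent; injectivity forces a
    nonzero coefficient at [y], by which one divides. *)
Lemma linear_system_solvable (n : nat) (v : nat -> nat -> R) (y : nat -> R) :
  (forall x : nat -> R, (forall i, (i < n)%nat -> fsum n (fun j => x j * v j i) = 0) ->
     forall j, (j < n)%nat -> x j = 0) ->
  exists x, forall i, (i < n)%nat -> fsum n (fun j => x j * v j i) = y i.
Proof.
  intros Inj.
  destruct (vectors_dependent n (fun j => if Nat.eqb j n then y else v j))
    as (c & (j & J & C) & H).
  assert (H' : forall i, (i < n)%nat -> fsum n (fun j => c j * v j i) + c n * y i = 0).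
  { intros i I; rewrite <- (H i I); simpl; rewrite Nat.eqb_refl; f_equal.
    apply fsum_ext; intros l L; destruct (Nat.eqb_spec l n); [lia|reflexivity]. }
  assert (N : c n <> 0).
  { intros Z; destruct (Nat.eq_dec j n) as [->|D]; [auto|].
    apply C, Inj; [|lia]; intros i I; rewrite <- (H' i I), Z; ring. }
  exists (fun j => - / c n * c j); intros i I.
  rewrite (fsum_ext _ _ (fun j => - / c n * (c j * v j i))) by (intros; ring).
  rewrite fsum_scal.
  replace (fsum n (fun j => c j * v j i)) with (- (c n * y i)) by (specialize (H' i I); lra).
  field; exact N.
Qed.

(** For [d n = 2 - lam - b n] this is [HD b - lam]. *)
Definition jacobi (d : Z -> R) (phi : Z -> R) (n : Z) : R :=
  d n * phi n - phi (n + 1)%Z - phi (n - 1)%Z.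

(** Fixed-point iteration, started at 0, for the equation [jacobi d phi = psi] solved for its
    diagonal term. *)
Fixpoint jacobi_iter (d psi : Z -> R) (k : nat) (n : Z) : R :=
  match k with
  | O => 0
  | S k => (psi n + jacobi_iter d psi k (n + 1)%Z + jacobi_iter d psi k (n - 1)%Z) / d n
  end.

Section JacobiIter.

Variables (d psi : Z -> R) (eta : R).
Hypothesis eta_pos : 0 < eta.
Hypothesis d_ge : forall n, 2 + eta <= d n.
Hypothesis psi_nonneg : forall n, 0 <= psi n.
Hypothesis psi_l2 : is_l2 psi.

(** The iteration step has nonnegative coefficients, so it preserves the order of the first two
    iterates. *)
Lemma jacobi_iter_mono (k : nat) (n : Z) :
  0 <= jacobi_iter d psi k n <= jacobi_iter d psi (S k) n.
Proof.
  revert n; induction k as [|k IH]; intros n; pose proof (d_ge n) as D;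
    assert (I : 0 < / d n) by (apply Rinv_0_lt_compat; lra).
  - simpl; split; [lra|]; apply Rmult_le_pos; [|lra].
    specialize (psi_nonneg n); lra.
  - pose proof (IH (n + 1)%Z) as [A1 A2]; pose proof (IH (n - 1)%Z) as [B1 B2].
    split; [destruct (IH n); lra|].
    change (jacobi_iter d psi (S (S k)) n) with
      ((psi n + jacobi_iter d psi (S k) (n + 1)%Z + jacobi_iter d psi (S k) (n - 1)%Z) / d n).
    change (jacobi_iter d psi (S k) n) with
      ((psi n + jacobi_iter d psi k (n + 1)%Z + jacobi_iter d psi k (n - 1)%Z) / d n).
    apply Rmult_le_compat_r; lra.
Qed.

(** Only membership is needed here, so the crude bound [/ d n <= 1] suffices. *)
Lemma jacobi_iter_l2 (k : nat) : is_l2 (jacobi_iter d psi k).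
Proof.
  induction k as [|k IH].
  - apply (is_sumZ_ext (fun _ => 0) _ 0); [intros; simpl; ring|apply is_sumZ_zero].
  - apply (is_l2_le _ (fun n => psi n + jacobi_iter d psi k (n + 1)%Z
                                 + jacobi_iter d psi k (n + -1)%Z)).
    + intros n; specialize (d_ge n); simpl.
      unfold Rdiv; rewrite Rabs_mult, Rabs_inv, (Rabs_right (d n)) by lra.
      rewrite <- Rmult_1_r; apply Rmult_le_compat_l; [apply Rabs_pos|].
      rewrite <- Rinv_1; apply Rinv_le_contravar; lra.
    + repeat apply is_l2_plus; auto; now apply is_l2_shift.
Qed.

(* By monotonicity the iterate [u = jacobi_iter k] satisfies [jacobi d u <= psi] pointwise;
   multiplying by [u >= 0] and summing bounds its norm independently of [k]. *)
Lemma jacobi_iter_norm (k : nat) (l P : R) :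
  is_sumZ (fun n => jacobi_iter d psi k n ^ 2) l -> is_sumZ (fun n => psi n ^ 2) P ->
  l <= P / eta ^ 2.
Proof.
  set (u := jacobi_iter d psi k); intros L HP.
  pose proof (is_sumZ_succ _ _ L) as L1; pose proof (is_sumZ_pred _ _ L) as L2.
  cbv beta in L1, L2.
  (* AM-GM on [psi n * u n] uses half of the gap [eta]; the neighbour terms contribute exactly [l],
     which leaves (eta / 2) l <= P / (2 eta). *)
  assert (Q : (1 + eta / 2) * l <= / (2 * eta) * P + / 2 * (l + l)).
  { refine (is_sumZ_le (fun n => (1 + eta / 2) * u n ^ 2)
      (fun n => / (2 * eta) * psi n ^ 2 + / 2 * (u (n + 1)%Z ^ 2 + u (n - 1)%Z ^ 2))
      _ _ _ (is_sumZ_scal _ _ _ L) _).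
    2:{ apply is_sumZ_plus; [now apply is_sumZ_scal|].
        now apply is_sumZ_scal, is_sumZ_plus. }
    intros n; destruct (jacobi_iter_mono k n) as [U0 U1]; fold u in U0, U1.
    pose proof (d_ge n) as D.
    assert (E : d n * u n <= psi n + u (n + 1)%Z + u (n - 1)%Z).
    { apply Rle_trans with (d n * jacobi_iter d psi (S k) n).
      - apply Rmult_le_compat_l; lra.
      - right; simpl; fold u; field; lra. }
    assert (E1 : (2 + eta) * u n * u n <= (psi n + u (n + 1)%Z + u (n - 1)%Z) * u n).
    { apply Rmult_le_compat_r; [exact U0|]; nra. }
    assert (Y : psi n * u n <= / (2 * eta) * psi n ^ 2 + eta / 2 * u n ^ 2).
    { assert (I : 0 < / (2 * eta)) by (apply Rinv_0_lt_compat; lra).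
      pose proof (Rmult_le_pos _ _ (Rlt_le _ _ I) (pow2_ge_0 (psi n - eta * u n))) as S.
      replace (/ (2 * eta) * (psi n - eta * u n) ^ 2) with
        (/ (2 * eta) * psi n ^ 2 + eta / 2 * u n ^ 2 - psi n * u n) in S by (field; lra).
      lra. }
    pose proof (pow2_ge_0 (u n - u (n + 1)%Z)); pose proof (pow2_ge_0 (u n - u (n - 1)%Z)).
    nra. }
  assert (Q' : eta * l <= / eta * P).
  { replace (/ eta * P) with (2 * (/ (2 * eta) * P)) by (field; lra); lra. }
  apply Rmult_le_reg_l with (eta ^ 2); [nra|].
  replace (eta ^ 2 * (P / eta ^ 2)) with (eta * (/ eta * P)) by (field; lra).
  replace (eta ^ 2 * l) with (eta * (eta * l)) by ring.
  apply Rmult_le_compat_l; lra.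
Qed.

(** The iterates increase and are bounded, so they converge pointwise; Fatou's lemma puts the limit
    in l^2, and the iteration step passes to the limit. *)
Lemma jacobi_solvable_nonneg : exists phi, is_l2 phi /\ forall n, jacobi d phi n = psi n.
Proof.
  set (u := jacobi_iter d psi).
  set (C := sumZ (fun n => psi n ^ 2) / eta ^ 2).
  assert (B : forall k l, is_sumZ (fun n => u k n ^ 2) l -> l <= C).
  { intros k l L; apply (jacobi_iter_norm k); [exact L|now apply is_sumZ_sumZ]. }
  assert (L : forall n, ex_finite_lim_seq (fun k => u k n)).
  (* From u^2 <= C and u <= 1 + u^2, a pointwise bound without square roots. *)
  { intros n; apply ex_finite_lim_seq_incr with (1 + C); intros k.
    - apply jacobi_iter_mono.
    - pose proof (is_sumZ_sumZ _ (jacobi_iter_l2 k)) as S; fold u in S.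
      pose proof (B k _ S).
      pose proof (is_sumZ_term _ _ n (fun j => pow2_ge_0 (u k j)) S); simpl in *.
      pose proof (pow2_ge_0 (u k n - 1)); nra. }
  assert (L' : forall n, is_lim_seq (fun k => u k n) (real (Lim_seq (fun k => u k n)))).
  { intros n; now apply Lim_seq_correct'. }
  exists (fun n => real (Lim_seq (fun k => u k n))); split.
  - apply (ex_sumZ_fatou (fun k n => u k n ^ 2) _ C).
    + intros; apply pow2_ge_0.
    + intros k; exists (sumZ (fun n => u k n ^ 2)).
      pose proof (is_sumZ_sumZ _ (jacobi_iter_l2 k)) as S; fold u in S; split; eauto.
    + intros n; simpl.
      apply is_lim_seq_mult'; [apply L'|].
      apply is_lim_seq_mult'; [apply L'|apply is_lim_seq_const].
  - intros n; unfold jacobi; specialize (d_ge n).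
    set (x := real (Lim_seq (fun k => u k n))).
    set (y := real (Lim_seq (fun k => u k (n + 1)%Z))).
    set (z := real (Lim_seq (fun k => u k (n - 1)%Z))).
    assert (E : x = (psi n + y + z) * / d n).
    { assert (E : Finite x = Finite ((psi n + y + z) * / d n)); [|now injection E].
      transitivity (Lim_seq (fun k => u (S k) n)).
      { symmetry; apply is_lim_seq_unique.
        now apply (is_lim_seq_incr_1 (fun k => u k n)). }
      apply is_lim_seq_unique.
      apply (is_lim_seq_ext (fun k => (psi n + u k (n + 1)%Z + u k (n - 1)%Z) * / d n)).
      - intros k; reflexivity.
      - apply is_lim_seq_mult'; [|apply is_lim_seq_const].
        apply is_lim_seq_plus'; [|apply L'].
        apply is_lim_seq_plus'; [apply is_lim_seq_const|apply L']. }
    rewrite E; field; lra.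
Qed.

End JacobiIter.

(** By linearity, from the positive and negative parts of [psi]. *)
Lemma jacobi_solvable (d psi : Z -> R) (eta : R) :
  0 < eta -> (forall n, 2 + eta <= d n) -> is_l2 psi ->
  exists phi, is_l2 phi /\ forall n, jacobi d phi n = psi n.
Proof.
  intros E D F.
  destruct (jacobi_solvable_nonneg d (fun n => Rmax (psi n) 0) eta) as (u & U & EU); auto.
  { intros; apply Rmax_r. }
  { apply is_l2_le with (2 := F); intros n.
    unfold Rmax; destruct (Rle_dec (psi n) 0); [rewrite Rabs_R0; apply Rabs_pos|lra]. }
  destruct (jacobi_solvable_nonneg d (fun n => Rmax (- psi n) 0) eta) as (v & V & EV); auto.
  { intros; apply Rmax_r. }
  { apply is_l2_le with (2 := F); intros n.
    unfold Rmax; destruct (Rle_dec (- psi n) 0);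
      [rewrite Rabs_R0; apply Rabs_pos|rewrite Rabs_Ropp; lra]. }
  exists (fun n => u n + -1 * v n); split.
  - now apply is_l2_plus, is_l2_scal.
  - intros n; transitivity (jacobi d u n - jacobi d v n); [unfold jacobi; ring|].
    rewrite EU, EV; unfold Rmax.
    destruct (Rle_dec (psi n) 0), (Rle_dec (- psi n) 0); lra.
Qed.

(** * Discreteness of the negative spectrum *)

Definition is_eigenvalue (b : Z -> R) (lam : R) : Prop :=
  exists phi, is_eigvec b lam phi /\ exists n, phi n <> 0.

(** The terms b^(3/2) tend to 0 along both half-lines, and x^(3/2) is increasing. *)
Lemma l32_small_outside (b : Z -> R) (eps : R) :
  (forall n, 0 <= b n) -> in_l32 b -> 0 < eps ->
  exists N : nat, forall n, ~ (- Z.of_nat N <= n < Z.of_nat N)%Z -> b n <= eps.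
Proof.
  intros P B E; destruct (ex_sumZ_l32 b P B) as [L1 L2].
  apply ex_series_lim_0, is_lim_seq_spec in L1; apply ex_series_lim_0, is_lim_seq_spec in L2.
  assert (E' : 0 < eps * sqrt eps) by (apply Rmult_lt_0_compat; [|apply sqrt_lt_R0]; exact E).
  destruct (L1 (mkposreal _ E')) as [N1 H1]; destruct (L2 (mkposreal _ E')) as [N2 H2].
  assert (S : forall n, Rabs (b n * sqrt (b n) - 0) < eps * sqrt eps -> b n <= eps).
  { intros n H; destruct (Rle_lt_dec (b n) eps) as [L|L]; [exact L|].
    apply Rlt_not_le in H; exfalso; apply H.
    rewrite Rminus_0_r; apply Rle_trans with (2 := Rle_abs _).
    apply Rmult_le_compat; [lra|apply sqrt_pos|lra|apply sqrt_le_1_alt; lra]. }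
  exists (max N1 N2); intros n N; apply S; destruct (Z_lt_le_dec n 0).
  - specialize (H2 (Z.to_nat (- n - 1))); simpl in H2.
    replace (- Z.of_nat (Z.to_nat (- n - 1)) - 1)%Z with n in H2 by lia; apply H2; lia.
  - specialize (H1 (Z.to_nat n)); simpl in H1.
    replace (Z.of_nat (Z.to_nat n)) with n in H1 by lia; apply H1; lia.
Qed.

Lemma jacobi_fsum (d : Z -> R) (m : nat) (c : nat -> R) (g : nat -> Z -> R) (n : Z) :
  jacobi d (fun k => fsum m (fun j => c j * g j k)) n
    = fsum m (fun j => c j * jacobi d (g j) n).
Proof.
  unfold jacobi; induction m as [|m IH]; simpl; [ring|rewrite <- IH; ring].
Qed.

(* Fredholm alternative: outside a large window [b] is at most [-lam/2], so [HD b - lam] is a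
   finite-rank perturbation of a solvable Jacobi operator. *)
Lemma resolvent_solvable (b : Z -> R) (lam : R) :
  (forall n, 0 <= b n) -> in_l32 b -> lam < 0 ->
  (forall phi, is_eigvec b lam phi -> forall n, phi n = 0) ->
  forall psi, is_l2 psi -> exists phi, is_l2 phi /\ forall n, HD b phi n - lam * phi n = psi n.
Proof.
  intros P B L Inj psi Psi.
  destruct (l32_small_outside b (- lam / 2) P B) as [N HN]; [lra|].
  set (inside := fun n => andb (- Z.of_nat N <=? n)%Z (n <? Z.of_nat N)%Z).
  (* Dropping [b] inside the window makes the gap at least [- lam / 2] at every site. *)
  set (d := fun n => if inside n then 2 - lam else 2 - lam - b n).
  assert (Hd : forall n, 2 + - lam / 2 <= d n).
  { intros n; unfold d; destruct (inside n) eqn:I; [lra|].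
    assert (b n <= - lam / 2); [|lra]; apply HN; intros [I1 I2].
    unfold inside in I; apply Bool.andb_false_iff in I; destruct I as [I|I]; lia. }
  set (M := (2 * N)%nat).
  set (p := fun j => (Z.of_nat j - Z.of_nat N)%Z).
  (* [g j] is the Green function of [jacobi d] with pole at the site [p j] of the window. *)
  assert (Hg : forall j, exists g, is_l2 g /\
    forall n, jacobi d g n = if Z.eqb n (p j) then 1 else 0).
  { intros j; apply (jacobi_solvable d _ (- lam / 2)); [lra|exact Hd|].
    apply (is_sumZ_ext (fun n => if Z.eqb n (p j) then 1 else 0) _ 1);
      [intros n; destruct (Z.eqb n (p j)); ring|apply is_sumZ_single]. }
  destruct (functional_choice _ Hg) as [g G].
  destruct (jacobi_solvable d psi (- lam / 2)) as (h & Hh & Eh); [lra|exact Hd|exact Psi|].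
  assert (W : forall f n, fsum M (fun j => f (p j) * (if Z.eqb n (p j) then 1 else 0))
                = if inside n then f n else 0).
  { intros f n; destruct (inside n) eqn:I.
    - unfold inside in I; apply Bool.andb_true_iff in I; destruct I as [I1 I2].
      assert (K : n = p (Z.to_nat (n + Z.of_nat N))) by (unfold p; lia).
      transitivity (f (p (Z.to_nat (n + Z.of_nat N)))); [|now rewrite <- K].
      rewrite <- (fsum_single M (Z.to_nat (n + Z.of_nat N)) (fun j => f (p j)))
        by (unfold M; lia).
      apply fsum_ext; intros j J; f_equal.
      destruct (Z.eqb_spec n (p j)), (Nat.eqb_spec (Z.to_nat (n + Z.of_nat N)) j);
        unfold p in *; auto; lia.
    - transitivity (fsum M (fun _ => 0)); [|apply fsum_zero]; apply fsum_ext; intros j J.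
      destruct (Z.eqb_spec n (p j)) as [->|]; [|ring].
      unfold inside, p in I; apply Bool.andb_false_iff in I; unfold M in J.
      destruct I as [I|I]; lia. }
  (* The potential inside the window acts as a source: [phi] solves the full equation once each
     [x i] equals [phi (p i)], which is a linear system of size [M]. It is used with [q = 0] for
     injectivity and with [q = h] for existence. *)
  assert (K : forall q rhs (x : nat -> R), (forall n, jacobi d q n = rhs n) ->
    (forall i, (i < M)%nat -> x i - fsum M (fun j => x j * b (p j) * g j (p i)) = q (p i)) ->
    forall n, let phi := fun k => q k + fsum M (fun j => x j * b (p j) * g j k) in
      HD b phi n - lam * phi n = rhs n).
  { intros q rhs x Q X n phi.
    assert (F : forall i, (i < M)%nat -> phi (p i) = x i).
    { intros i I; unfold phi; rewrite <- X by exact I; ring. }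
    assert (J : jacobi d phi n = rhs n + if inside n then b n * phi n else 0).
    { transitivity (jacobi d q n
        + jacobi d (fun k => fsum M (fun j => x j * b (p j) * g j k)) n);
        [unfold jacobi, phi; ring|].
      rewrite Q, jacobi_fsum; f_equal.
      rewrite <- (W (fun n => b n * phi n) n); apply fsum_ext; intros j I.
      rewrite F by exact I; rewrite (proj2 (G j)); ring. }
    unfold jacobi, d in J; unfold HD; destruct (inside n); lra. }
  assert (L2 : forall x : nat -> R, is_l2 (fun k => fsum M (fun j => x j * b (p j) * g j k))).
  { intros x; apply is_l2_fsum; intros; apply is_l2_scal, G. }
  assert (V : forall (x : nat -> R) i, (i < M)%nat ->
    fsum M (fun j => x j * ((if Nat.eqb i j then 1 else 0) - b (p j) * g j (p i)))
      = x i - fsum M (fun j => x j * b (p j) * g j (p i))).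
  { intros x i I.
    rewrite (fsum_ext _ _ (fun j => x j * (if Nat.eqb i j then 1 else 0)
      + -1 * (x j * b (p j) * g j (p i)))) by (intros; ring).
    rewrite fsum_plus, fsum_scal, fsum_single by exact I; ring. }
  destruct (linear_system_solvable M
    (fun j i => (if Nat.eqb i j then 1 else 0) - b (p j) * g j (p i)) (fun i => h (p i)))
    as [x X].
  - intros x X j J.
    assert (X' : forall i, (i < M)%nat ->
      x i - fsum M (fun j => x j * b (p j) * g j (p i)) = 0).
    { intros i I; rewrite <- V by exact I; now apply X. }
    (* A kernel element of the system gives a solution of the eigenvalue equation, which vanishes by
       [Inj]; its values at the window sites are the [x j]. *)
    assert (Z : fsum M (fun k => x k * b (p k) * g k (p j)) = 0).
    { apply (Inj (fun n => fsum M (fun k => x k * b (p k) * g k n))); split; [apply L2|].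
      intros n.
      pose proof (K (fun _ => 0) (fun _ => 0) x
        (fun n => ltac:(unfold jacobi; ring)) X' n) as E; simpl in E.
      unfold HD in *; lra. }
    specialize (X' j J); lra.
  - exists (fun n => h n + fsum M (fun j => x j * b (p j) * g j n)); split.
    + apply is_l2_plus; [exact Hh|apply L2].
    + apply (K h psi x Eh); intros i I; rewrite <- V by exact I; now apply X.
Qed.

(** If [lam] is not an eigenvalue, the homogeneous equation has only the zero solution; this gives
    uniqueness and, by the Fredholm alternative, existence. *)
Lemma negative_spectrum_eigenvalue (b : Z -> R) (lam : R) :
  (forall n, 0 <= b n) -> in_l32 b -> lam < 0 -> in_spectrum b lam -> is_eigenvalue b lam.
Proof.
  intros P B L S; apply NNPP; intros N; apply S.
  assert (Inj : forall phi, is_eigvec b lam phi -> forall n, phi n = 0).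
  { intros phi E n; apply NNPP; intros Z; apply N; exists phi; eauto. }
  intros psi Psi.
  destruct (resolvent_solvable b lam P B L Inj psi Psi) as (phi & Phi & E).
  exists phi; split; [exact Phi|split; [exact E|]]; intros phi' Phi' E'.
  apply functional_extensionality; intros n.
  enough (phi' n + -1 * phi n = 0) by lra.
  apply (Inj (fun n => phi' n + -1 * phi n)); split; [now apply is_l2_plus, is_l2_scal|].
  intros k; specialize (E k); specialize (E' k); unfold HD in *; lra.
Qed.

(** * Multiplicity, orthogonality and isolation of eigenvalues *)

Lemma fsum_truncate (k m : nat) (f : nat -> R) : (k <= m)%nat ->
  fsum m (fun j => if Nat.ltb j k then f j else 0) = fsum k f.
Proof.
  induction 1 as [|m H IH].
  - apply fsum_ext; intros j J; destruct (Nat.ltb_spec j k); [reflexivity|lia].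
  - simpl; rewrite IH; destruct (Nat.ltb_spec m k); [lia|ring].
Qed.

(* An eigenvector is a solution of a second order recurrence, determined by its values
   at [0] and [1]. *)
Lemma eigenspace_dimension (b : Z -> R) (lam : R) (m : nat) (phi : nat -> Z -> R) :
  (forall j, (j < m)%nat -> is_eigvec b lam (phi j)) -> lin_indep m phi -> (m <= 2)%nat.
Proof.
  intros E I; destruct (le_gt_dec m 2) as [|M]; [assumption|exfalso].
  (* Three pairs of initial values in R^2 are dependent; the coefficients are then extended by zero
     to all [m] vectors. *)
  destruct (vectors_dependent 2 (fun j i => phi j (Z.of_nat i))) as (c & (j & J & C) & H).
  apply C; replace (c j) with (if Nat.ltb j 3 then c j else 0)
    by (destruct (Nat.ltb_spec j 3); [reflexivity|lia]).
  apply (I (fun j => if Nat.ltb j 3 then c j else 0)); [|lia].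
  intros n; set (chi := fun n => fsum 3 (fun j => c j * phi j n)).
  rewrite (fsum_ext _ _ (fun j => if Nat.ltb j 3 then c j * phi j n else 0))
    by (intros k _; destruct (Nat.ltb k 3); ring).
  rewrite fsum_truncate by exact M; change (chi n = 0).
  assert (Rec : forall k, chi (k + 1)%Z = (2 - b k - lam) * chi k - chi (k - 1)%Z).
  { intros k; unfold chi; simpl.
    pose proof (proj2 (E 0%nat ltac:(lia)) k); pose proof (proj2 (E 1%nat ltac:(lia)) k);
      pose proof (proj2 (E 2%nat ltac:(lia)) k); unfold HD in *.
    replace (phi 0%nat (k + 1)%Z) with ((2 - b k - lam) * phi 0%nat k - phi 0%nat (k - 1)%Z) by lra.
    replace (phi 1%nat (k + 1)%Z) with ((2 - b k - lam) * phi 1%nat k - phi 1%nat (k - 1)%Z) by lra.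
    replace (phi 2%nat (k + 1)%Z) with ((2 - b k - lam) * phi 2%nat k - phi 2%nat (k - 1)%Z) by lra.
    ring. }
  (* Two consecutive zeros propagate through the recurrence in both directions. *)
  enough (Q : chi n = 0 /\ chi (n + 1)%Z = 0) by apply Q.
  induction n as [|n IH|n IH] using Z.peano_ind.
  - split; [apply (H 0%nat)|apply (H 1%nat)]; lia.
  - unfold Z.succ; split; [apply IH|]; rewrite Rec.
    replace (n + 1 - 1)%Z with n by lia; destruct IH as [-> ->]; ring.
  - unfold Z.pred; replace (n + -1 + 1)%Z with n by lia; split; [|apply IH].
    pose proof (Rec n) as Rn; destruct IH as [I0 I1]; rewrite I0, I1 in Rn.
    replace (n + -1)%Z with (n - 1)%Z by lia; lra.
Qed.

(* [(e - e') phi phi'] is the discrete derivative of the Wronskian of [phi] and [phi']. *)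
Lemma eigvec_orthogonal (b : Z -> R) (e e' : R) (phi phi' : Z -> R) :
  is_eigvec b e phi -> is_eigvec b e' phi' -> e <> e' -> inner phi phi' = 0.
Proof.
  intros [F E] [F' E'] D.
  set (w := fun n => phi (n + 1)%Z * phi' n - phi n * phi' (n + 1)%Z).
  assert (W : exists l, is_sumZ w l).
  { exists (sumZ (fun n => phi (n + 1)%Z * phi' n) - sumZ (fun n => phi n * phi' (n + 1)%Z)).
    apply is_sumZ_minus; apply is_sumZ_sumZ, ex_sumZ_mult; auto;
      now apply (is_l2_shift 1). }
  destruct W as [l W].
  assert (S : is_sumZ (fun n => (e - e') * (phi n * phi' n)) (l - l)).
  { apply (is_sumZ_ext (fun n => w (n - 1)%Z - w n)).
    - intros n; specialize (E n); specialize (E' n); unfold HD in E, E'; unfold w.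
      replace (n - 1 + 1)%Z with n by lia.
      replace ((e - e') * (phi n * phi' n)) with (e * phi n * phi' n - phi n * (e' * phi' n))
        by ring.
      rewrite <- E, <- E'; ring.
    - apply is_sumZ_minus; [now apply is_sumZ_pred|exact W]. }
  pose proof (is_sumZ_scal (e - e') _ _ (is_sumZ_sumZ _ (ex_sumZ_mult _ _ F F'))) as S'.
  destruct S as [_ S]; destruct S' as [_ S']; cbv beta in S'.
  rewrite S in S'; apply (Rmult_eq_reg_l (e - e')); [|lra].
  unfold inner; lra.
Qed.

Lemma eigenvalue_normalized (b : Z -> R) (lam : R) :
  is_eigenvalue b lam -> exists phi, is_eigvec b lam phi /\ inner phi phi = 1.
Proof.
  intros (phi & [F E] & n & N).
  pose proof (is_sumZ_sumZ _ (ex_sumZ_mult _ _ F F)) as S.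
  set (B := sumZ (fun n => phi n * phi n)) in S.
  assert (PB : 0 < B).
  { apply Rlt_le_trans with (phi n * phi n); [nra|].
    apply (is_sumZ_term (fun n => phi n * phi n)); [intros; nra|exact S]. }
  pose proof (sqrt_lt_R0 _ PB); pose proof (sqrt_sqrt B (Rlt_le _ _ PB)) as Q.
  exists (fun n => / sqrt B * phi n); split; [split|].
  - now apply is_l2_scal.
  - intros k; specialize (E k); unfold HD in *.
    replace (lam * (/ sqrt B * phi k)) with (/ sqrt B * (lam * phi k)) by ring.
    rewrite <- E; ring.
  - transitivity (/ B * B); [|field; lra].
    apply (is_sumZ_ext _ (fun n => / sqrt B * phi n * (/ sqrt B * phi n))
      _) with (2 := is_sumZ_scal (/ B) _ _ S).
    intros k; rewrite <- Q at 1; field; lra.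
Qed.

(** Each new eigenvalue is chosen closer to [lam] than all earlier ones, hence differs from them and
    has an orthogonal eigenvector. [delta] is a lower bound for the distances so far;
    [delta <= - lam / 2] keeps the next eigenvalue below [lam / 2]. *)
Lemma accumulating_eigenvalues (b : Z -> R) (lam : R) : lam < 0 ->
  (forall eps, 0 < eps -> exists mu, 0 < Rabs (mu - lam) < eps /\ is_eigenvalue b mu) ->
  forall m : nat, exists (e : nat -> R) (phi : nat -> Z -> R) (delta : R),
    0 < delta <= - lam / 2 /\
    (forall j, (j < m)%nat ->
       delta <= Rabs (e j - lam) /\ e j <= lam / 2 /\ is_eigvec b (e j) (phi j)) /\
    (forall i j, (i < m)%nat -> (j < m)%nat ->
       inner (phi i) (phi j) = if Nat.eqb i j then 1 else 0).
Proof.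
  intros L Acc m; induction m as [|m (e & phi & delta & D & H & O)].
  - exists (fun _ => 0), (fun _ _ => 0), (- lam / 2); repeat split; intros; try lra; lia.
  - destruct (Acc delta ltac:(lra)) as (mu & M & Eig).
    destruct (eigenvalue_normalized _ _ Eig) as (psi & Psi & N).
    assert (Near : mu <= lam / 2).
    { destruct M as [_ M]; apply Rabs_def2 in M; lra. }
    assert (Orth : forall j, (j < m)%nat -> e j <> mu).
    { intros j J Q; destruct (H j J) as [H1 _]; rewrite Q in H1; lra. }
    exists (fun j => if Nat.eqb j m then mu else e j),
      (fun j => if Nat.eqb j m then psi else phi j), (Rabs (mu - lam)).
    split; [lra|split].
    + intros j J; destruct (Nat.eqb_spec j m); [repeat split; (lra || apply Psi)|].
      destruct (H j ltac:(lia)) as (H1 & H2 & H3); split; [lra|now split].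
    + intros i j I J; destruct (Nat.eqb_spec i m) as [->|Di], (Nat.eqb_spec j m) as [->|Dj].
      * now rewrite Nat.eqb_refl.
      * destruct (Nat.eqb_spec m j); [lia|].
        apply (eigvec_orthogonal b mu (e j)); [exact Psi|apply (H j ltac:(lia))|].
        apply not_eq_sym, Orth; lia.
      * destruct (Nat.eqb_spec i m); [lia|].
        apply (eigvec_orthogonal b (e i) mu); [apply (H i ltac:(lia))|exact Psi|].
        apply Orth; lia.
      * apply O; lia.
Qed.

Lemma eigenvalues_isolated (b : Z -> R) (lam : R) :
  (forall n, 0 <= b n) -> in_l32 b -> lam < 0 ->
  exists eps, 0 < eps /\ forall mu, 0 < Rabs (mu - lam) < eps -> ~ is_eigenvalue b mu.
Proof.
  intros P B L; apply NNPP; intros N.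
  assert (Acc : forall eps, 0 < eps ->
    exists mu, 0 < Rabs (mu - lam) < eps /\ is_eigenvalue b mu).
  { intros eps E; apply NNPP; intros N'; apply N; exists eps; split; [exact E|].
    intros mu M Q; apply N'; eauto. }
  set (C := PI / sqrt 3 * Lcl11 * sumZ (fun n => b n * sqrt (b n))).
  (* Each of the [m] eigenvalues below [lam / 2] adds at least [- lam / 2] to the trace, so this [m]
     violates the bound [C]. *)
  destruct (INR_unbounded (C / (- lam / 2))) as [m M].
  destruct (accumulating_eigenvalues b lam L Acc m) as (e & phi & delta & _ & H & O).
  assert (LT : fsum m (fun j => Rabs (e j)) <= C).
  { apply (lieb_thirring b m e phi P B); [|exact O].
    intros j J; destruct (H j J) as (_ & H2 & H3); split; [lra|exact H3]. }
  assert (GE : INR m * (- lam / 2) <= fsum m (fun j => Rabs (e j))).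
  { rewrite <- fsum_const; apply fsum_le; intros j J.
    destruct (H j J) as (_ & H2 & _); rewrite Rabs_left; lra. }
  apply (Rmult_lt_compat_r (- lam / 2)) in M; [|lra].
  replace (C / (- lam / 2) * (- lam / 2)) with C in M by (field; lra); lra.
Qed.

Theorem theorem1p2 (b : Z -> R) (hb0 : forall n, 0 <= b n) (hb : in_l32 b) :
  (forall lam, lam < 0 -> in_spectrum b lam -> discrete_eigenvalue b lam) /\
  (forall (m : nat) (e : nat -> R) (phi : nat -> Z -> R),
     (forall j, (j < m)%nat -> e j < 0 /\ is_eigvec b (e j) (phi j)) ->
     (forall i j, (i < m)%nat -> (j < m)%nat ->
        inner (phi i) (phi j) = if Nat.eqb i j then 1 else 0) ->
     fsum m (fun j => Rabs (e j)) <=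
       PI / sqrt 3 * Lcl11 * sumZ (fun n => b n * sqrt (b n))).
Proof.
  split; [|intros m e phi; now apply lieb_thirring].
  intros lam L S; split; [|split].
  - destruct (eigenvalues_isolated b lam hb0 hb L) as (eps & E & H).
    (* The radius [- lam] keeps [mu] negative, where spectral points are eigenvalues. *)
    exists (Rmin eps (- lam)); split; [apply Rmin_pos; lra|].
    intros mu [M1 M2] Q.
    pose proof (Rmin_l eps (- lam)); pose proof (Rmin_r eps (- lam)).
    apply (H mu); [lra|].
    apply negative_spectrum_eigenvalue; auto.
    pose proof (Rle_abs (mu - lam)); lra.
  - now apply negative_spectrum_eigenvalue.
  - exists 2%nat; intros m phi; apply eigenspace_dimension.
Qed.
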